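(* Let $a\in A$ be invertible such that $KaK$ is a simple $K$-$K$-bimodule, associated to the double coset $HgH$, and for $m\ge 0$ put $$K(a,m)=(KaK)^m a^{-m}=K(aKa^{-1})(a^2Ka^{-2})\cdots(a^mKa^{-m}).$$ If $K(a,m)=K(a,m+1)$ then $K(a,m)=K(a,m+s)$ for all $s\ge 0$. Moreover, the chain $$K=K(a,0)\subseteq K(a,1)\subseteq K(a,2)\subseteq\cdots$$ stabilizes at some $m\le n$. Thus $\dim_K (KaK)^m$ stabilizes at the same $m$. Similarly, the sets $$H(g,m)=(HgH)^m g^{-m}=H(gHg^{-1})(g^2Hg^{-2})\cdots(g^mHg^{-m})$$ form an ascending chain of subsets $H=H(g,0)\subseteq H(g,1)\subseteq H(g,2)\subseteq\cdots$, so $|(HgH)^m|$ stabilizes.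
   Context: Setting: $F$ is a field, $A$ is a central simple $F$-algebra of degree $n$ (so $\dim_F A=n^2$), and $K\subset A$ is a maximal subfield, separable over $F$, with $[K:F]=n$. $L$ is the Galois closure of $K/F$, $G=\mathrm{Gal}(L/F)$, $H=\mathrm{Gal}(L/K)$. For $a\in A$, $KaK$ denotes the $F$-span of all $kak'$ with $k,k'\in K$; products of subspaces of $A$ are the $F$-spans of the products of elements; $(KaK)^0=K$ and $(HgH)^0=H$. Dimensions over $K$ are with respect to left multiplication. Association of sub-bimodules with bisets: for $g\in G$ let $\pi_{gH}:K\otimes_F K\to L$, $a\otimes b\mapsto a\,g(b)$, and let $K_{[g]}$ be the unique minimal ideal of the semisimple ring $K\otimes_F K$ not contained in $\ker\pi_{gH}$ (it depends only on $HgH$). Choose $v\in A$ with $KvK=A$ and let $\varphi_v:K\otimes_F K\to A$, $x\otimes y\mapsto xvy$ (a bimodule isomorphism). The sub-bimodule of $A$ associated to a double coset $HgH$ is $\varphi_v(K_{[g]})$ (independent of $v$); these are exactly the simple $K$-$K$ sub-bimodules of $A$. *)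

(* Defs.v *)
From HB Require Import structures.
From mathcomp Require Import all_boot all_order all_algebra all_fingroup all_field.

Set Implicit Arguments.
Unset Strict Implicit.
Unset Printing Implicit Defensive.

Import GRing.Theory.
Local Open Scope ring_scope.

(* m is the first index from which u is constant. *)
Definition stabilizes_at (T : Type) (u : nat -> T) (m : nat) : Prop :=
  (forall s, u (m + s)%N = u m) /\
  (forall k, (k < m)%N -> ~ (forall s, u (k + s)%N = u k)).

Section Algebras.
Variables (F : fieldType) (A : falgType F).
Implicit Types K M N : {vspace A}.

(* Two-sided ideals of a unital F-algebra are F-subspaces, and A is nonzero
   since 1 != 0 in every falgType. *)
Definition central_simple : Prop :=
  'Z({:A})%VS = 1%VS /\
  (forall I : {vspace A}, ({:A} * I <= I)%VS -> (I * {:A} <= I)%VS ->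
     I = 0%VS \/ I = fullv).

(* The identity of a {aspace A} may differ from that of A, hence 1 \in E. *)
Definition is_subfield (E : {aspace A}) : Prop :=
  [/\ 1 \in E,
      {in E &, forall x y, x * y = y * x}
    & {in E, forall x, x != 0 -> exists2 y, y \in E & x * y = 1}].

Definition maximal_subfield K : Prop :=
  exists E0 : {aspace A},
    [/\ E0 = K :> {vspace A}, is_subfield E0
      & forall E : {aspace A}, is_subfield E -> (K <= E)%VS ->
          E = K :> {vspace A}].

Definition sub_bimodule K M : Prop := (K * M <= M)%VS /\ (M * K <= M)%VS.

Definition simple_bimodule K M : Prop :=
  [/\ M <> 0%VS, sub_bimodule K M
    & forall N, (N <= M)%VS -> sub_bimodule K N -> N = 0%VS \/ N = M].

Definition KaK K (a : A) : {vspace A} := (K * <[a]> * K)%VS.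

Definition KaK_pow K (a : A) (m : nat) : {vspace A} :=
  if m is 0 then K else (KaK K a ^+ m)%VS.

Definition Kam K (a : A) (m : nat) : {vspace A} :=
  (KaK_pow K a m * <[a ^- m]>)%VS.

End Algebras.

Section Tensor.
Variables (F : fieldType) (K : fieldExtType F).

(* The F-algebra T together with tens (x, y |-> x (x) y) is the tensor product
   of K with itself over F.  T is then automatically commutative. *)
Definition is_tensor_square (T : falgType F) (tens : {bilinear K -> K -> T}) :
    Prop :=
  [/\ tens 1 1 = 1,
      forall x y x' y', tens x y * tens x' y' = tens (x * x') (y * y')
    & forall (V : lmodType F) (f : {bilinear K -> K -> V}),
        exists h : {linear T -> V},
          (forall x y, h (tens x y) = f x y) /\
          (forall h' : {linear T -> V},
             (forall x y, h' (tens x y) = f x y) -> h' =1 h)].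

(* One-sided condition: only used for the commutative algebra K (x) K. *)
Definition is_ideal (T : falgType F) (I : {vspace T}) : Prop :=
  ({:T} * I <= I)%VS.

Definition minimal_ideal (T : falgType F) (I : {vspace T}) : Prop :=
  [/\ I <> 0%VS, is_ideal I
    & forall J : {vspace T}, is_ideal J -> (J <= I)%VS -> J = 0%VS \/ J = I].

Variables (A : falgType F) (L : splittingFieldType F).
Variables (jA : 'AHom(K, A)) (jL : 'AHom(K, L)).
Variables (T : falgType F) (tens : {bilinear K -> K -> T}).

(* I is K_[g]: a minimal ideal of K (x) K not contained in the kernel of
   pi_gH : x (x) y |-> x g(y).  There is exactly one when tens is a tensor
   product and K / F is separable. *)
Definition is_K_bracket (g : gal_of {:L}) (I : {vspace T}) : Prop :=
  exists pi : 'Hom(T, L),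
    [/\ forall x y, pi (tens x y) = jL x * g (jL y),
        minimal_ideal I
      & ~ (I <= lker pi)%VS].

(* M is phi_v(K_[g]) for some v with KvK = A; M does not depend on v. *)
Definition associated_bimodule (g : gal_of {:L}) (M : {vspace A}) : Prop :=
  exists (v : A) (phi : 'Hom(T, A)) (I : {vspace T}),
    [/\ KaK (limg jA) v = fullv,
        forall x y, phi (tens x y) = jA x * v * jA y,
        is_K_bracket g I
      & M = (phi @: I)%VS].

(* L is the Galois closure of K over F: it is Galois over F, and no proper
   intermediate field of L / jL(K) is Galois over F. *)
Definition galois_closure : Prop :=
  galois 1%VS {:L} /\
  (forall E : {subfield L}, (limg jL <= E)%VS -> galois 1%VS E ->
     E = fullv :> {vspace L}).

End Tensor.

Section Bisets.
Variables (F : fieldType) (L : splittingFieldType F).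
Implicit Types (S H : {set gal_of {:L}}) (g : gal_of {:L}).

(* Automorphisms act on the left, st meaning s \o t, whereas in MathComp
   (x * y)%g is y \o x (lemma galM); the group law needed is therefore the
   opposite one.  Inverses, and powers of elements and of sets, are the
   same for both. *)
Definition compS S1 S2 : {set gal_of {:L}} := (S2 * S1)%g.

Definition HgH H g : {set gal_of {:L}} := compS (compS H [set g]) H.

Definition HgH_pow H g (m : nat) : {set gal_of {:L}} :=
  if m is 0 then H else (HgH H g ^+ m)%g.

Definition Hgm H g (m : nat) : {set gal_of {:L}} :=
  compS (HgH_pow H g m) [set (g ^- m)%g].

End Bisets.

(* Main.v *)
Require Import Defs.
From HB Require Import structures.
From mathcomp Require Import all_boot all_order all_algebra all_fingroup all_field.

Set Implicit Arguments.
Unset Strict Implicit.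
Unset Printing Implicit Defensive.

Import GRing.Theory.
Local Open Scope ring_scope.

(** Write k for K (resp. H) and x for a (resp. g).  Both halves of the statement
    are the same fact about an idempotent k and an invertible x in a monoid:
    subspaces of A under the product of subspaces, subsets of the Galois group
    under composition.  Since k k = k, the powers p_m = (k x k)^m, with p_0 = k,
    satisfy p_(m+1) = k x p_m.  Hence u_m = p_m x^-m satisfies

      u_(m+1) = k (x u_m x^-1),

    which unfolds to u_m = k (x k x^-1) ... (x^m k x^-m), and shows that u is the
    orbit of u_0 = k under the single map f : s |-> k (x s x^-1).  An orbit that
    repeats a value once is constant from there on ([orbit_stationary]).  The
    chain ascends because each factor x^i k x^-i contains the unit.

    Let mu be the dimension over K (resp. the cardinal).  It is strictly monotone
    on the chain, so before the first repetition it grows by at least 1 at each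
    step; as mu is bounded by dim_K A = n (resp. by the order of the group), the
    first repetition occurs at some m, and both u and mu o u stabilize exactly
    there ([orbit_stabilizes]).  Since mu(K) = 1, this gives even m < n.  As x is
    invertible, mu(u_m) = mu(p_m).

    Dimension over K appears as a quotient of F-dimensions; that strict inclusions
    survive the division relies on [K : F] dividing the F-dimension of every left
    K-submodule of A ([dvdn_dim_submodule]). *)

(** * Orbits and their stabilization *)

Section Orbit.
Variables (T : Type) (f : T -> T) (u : nat -> T).
Hypothesis uS : forall m, u m.+1 = f (u m).

Lemma orbit_stationary m : u m = u m.+1 -> forall s, u m = u (m + s)%N.
Proof.
move=> um; elim=> [|s IHs]; first by rewrite addn0.
by rewrite addnS uS -IHs -uS.
Qed.

End Orbit.

Lemma eq_stabilizes_at (T : Type) (u v : nat -> T) m :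
  u =1 v -> stabilizes_at u m -> stabilizes_at v m.
Proof.
move=> uv [st mini]; split=> [s|k km stk]; first by rewrite -!uv.
by apply: (mini k km) => s; rewrite !uv.
Qed.

(** The index m is the first repetition; before it mu increases strictly, which
    gives at once the bound on m and the fact that mu o u is not constant any
    earlier than u is. *)
Lemma orbit_stabilizes (T : eqType) (f : T -> T) (u : nat -> T)
    (mu : T -> nat) (N : nat) :
  (forall m, u m.+1 = f (u m)) ->
  (forall m, u m != u m.+1 -> (mu (u m) < mu (u m.+1))%N) ->
  (forall m, (mu (u m) <= N)%N) ->
  exists m, [/\ (mu (u 0) + m <= N)%N, stabilizes_at u m
              & stabilizes_at (fun k => mu (u k)) m].
Proof.
move=> uS mu_lt mu_le.
have grow m : (forall k, (k < m)%N -> u k != u k.+1) ->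
    (mu (u 0) + m <= mu (u m))%N.
  elim: m => [|m IHm] neq; first by rewrite addn0.
  rewrite addnS (leq_ltn_trans (IHm _)) ?mu_lt ?neq // => k km.
  exact/neq/ltnW.
have exm: exists m, u m == u m.+1.
  have [/existsP[i ui]|/existsPn neq] :=
    boolP [exists i : 'I_N.+1, u i == u i.+1]; first by exists i.
  have: (mu (u 0) + N.+1 <= mu (u N.+1))%N.
    by apply: grow => k kN; apply: (neq (Ordinal kN)).
  by move=> /leq_trans/(_ (mu_le _)); rewrite addnS ltnNge leq_addl.
case: (ex_minnP exm) => m /eqP um m_min.
have neq k : (k < m)%N -> u k != u k.+1.
  by move=> km; apply/negP => /m_min; rewrite leqNgt km.
have st := orbit_stationary uS um.
exists m; split; first exact: leq_trans (grow m neq) (mu_le m).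
- split=> [s|k /neq/eqP uk stk]; first by rewrite -st.
  by apply: uk; rewrite -(stk 1%N) addn1.
- split=> [s|k /neq/mu_lt mk stk]; first by rewrite -st.
  by move: mk; rewrite -(stk 1%N) addn1 ltnn.
Qed.

(** * Twisted powers of an idempotent in a monoid *)

(** In both applications [xp m] and [xn m] are the m-th powers of x and of x^-1,
    and [p m] is (k x k)^m; only their recurrences matter. *)
Section TwistedPower.
Variables (T : Type) (e : T) (op : Monoid.law e).
Variables (k : T) (xp xn p : nat -> T).
Local Notation "x * y" := (op x y).
Hypotheses (xp0 : xp 0%N = e) (xpS : forall m, xp m.+1 = xp 1%N * xp m).
Hypotheses (xn0 : xn 0%N = e) (xnS : forall m, xn m.+1 = xn m * xn 1%N).
Hypotheses (p0 : p 0%N = k) (pS : forall m, p m.+1 = k * xp 1%N * p m).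

Let opA : associative op. Proof. exact: Monoid.mulmA. Qed.

Lemma twisted_powerS m :
  p m.+1 * xn m.+1 = k * (xp 1%N * (p m * xn m) * xn 1%N).
Proof. by rewrite pS xnS !opA. Qed.

Hypothesis xVx : xn 1%N * xp 1%N = e.

(** Conjugation by x is multiplicative because x^-1 x = e. *)
Lemma big_conj n (F : 'I_n.+1 -> T) :
  \big[op/e]_(i < n.+1) (xp 1%N * F i * xn 1%N)
    = xp 1%N * (\big[op/e]_(i < n.+1) F i) * xn 1%N.
Proof.
have mulxVK s : s * xn 1%N * xp 1%N = s.
  by rewrite -opA xVx Monoid.mulm1.
elim: n F => [|n IHn] F; first by rewrite !big_ord1.
by rewrite big_ord_recl IHn [in RHS]big_ord_recl !opA mulxVK.
Qed.

Lemma twisted_power_big m :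
  p m * xn m = \big[op/e]_(i < m.+1) (xp i * k * xn i).
Proof.
elim: m => [|m IHm]; first by rewrite big_ord1 p0 xp0 Monoid.mul1m.
rewrite twisted_powerS IHm -big_conj [RHS]big_ord_recl xp0 xn0.
rewrite Monoid.mul1m Monoid.mulm1; congr (_ * _); apply: eq_bigr => i _.
by rewrite lift0 (xpS i) (xnS i) !opA.
Qed.

End TwistedPower.

(** * The chain of subspaces *)

Section Subspaces.
Variables (F : fieldType) (A : falgType F) (K : fieldExtType F).
Variable (j : 'AHom(K, A)).
Implicit Types (M N : {vspace A}) (a : A).
Local Notation KA := (limg j).

Lemma dim_limg_ahom : \dim KA = \dim {:K}.
Proof.
apply: limg_dim_eq; apply/eqP; rewrite capfv.
by apply/lker0P; apply: fmorph_inj.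
Qed.

Lemma limg_ahom_id : (KA * KA)%VS = KA.
Proof. by rewrite -aimgM prodv_id. Qed.

Lemma one_in_limg_ahom : 1 \in KA.
Proof. by rewrite -(rmorph1 j) memv_img ?memvf. Qed.

(** A cyclic submodule K y is isomorphic to K when y != 0, and meets trivially
    any submodule N that does not contain y: x y \in N with x != 0 forces
    y = x^-1 (x y) \in N.  So M is reached from 0 by adding subspaces of
    dimension [K : F]. *)
Lemma dvdn_dim_submodule M : (KA * M <= M)%VS -> (\dim KA %| \dim M)%N.
Proof.
move=> KM.
suff extend N : (KA * N <= N)%VS -> (N <= M)%VS -> (\dim KA %| \dim N)%N ->
    (\dim KA %| \dim M)%N.
  by apply: (extend 0%VS); rewrite ?prodv0 ?sub0v ?dimv0 ?dvdn0.
have [d] := ubnP (\dim M - \dim N); elim: d N => // d IHd N; rewrite ltnS => dMN KN NM dvdN.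
have [MN|/subvPn[y yM yN]] := boolP (M <= N)%VS.
  by rewrite (_ : M = N) //; apply: subv_anti; rewrite MN NM.
pose Ky := (KA * <[y]>)%VS.
have KyP z : reflect (exists x, z = j x * y) (z \in Ky).
  apply: (iffP memv_cosetP) => [[_ /memv_imgP[x _ ->] ->]|[x ->]].
    by exists x.
  by exists (j x); rewrite // memv_img ?memvf.
have jinv (x : K) : x != 0 -> forall z, z = j x^-1 * (j x * z).
  by move=> x0 z; rewrite mulrA -rmorphM mulVf // rmorph1 mul1r.
have capNKy : (N :&: Ky = 0)%VS.
  apply/eqP; rewrite -subv0; apply/subvP => z /memv_capP[zN /KyP[x zE]].
  have [x0|/jinv x0] := eqVneq x 0; first by rewrite zE x0 rmorph0 mul0r mem0v.
  case/negP: yN; rewrite (x0 y) -zE; apply: (subvP KN).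
  by rewrite memv_mul ?memv_img ?memvf.
have dimKy : \dim Ky = \dim KA.
  rewrite dim_limg_ahom /Ky -limg_amulr -limg_comp; apply: limg_dim_eq.
  apply/eqP; rewrite capfv; apply/lker0P => x x'; rewrite !comp_lfunE !lfunE /=.
  move/eqP; rewrite -subr_eq0 -mulrBl -rmorphB => /eqP xx'y.
  apply/eqP; rewrite -subr_eq0; apply: contraR yN => /jinv/(_ y) ->.
  by rewrite xx'y mulr0 mem0v.
have dimNKy : \dim (N + Ky) = (\dim N + \dim KA)%N.
  by rewrite dimv_disjoint_sum // dimKy.
have NKyM : (N + Ky <= M)%VS.
  by rewrite subv_add NM (subv_trans _ KM) // prodvSr // -memvE.
apply: (IHd (N + Ky)%VS) => //; last by rewrite dimNKy dvdn_add.
- have ltN : (\dim N < \dim (N + Ky))%N.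
    by rewrite dimNKy -[X in (X < _)%N]addn0 ltn_add2l dim_limg_ahom adim_gt0.
  by apply: leq_trans (ltn_sub2l _ ltN) dMN; rewrite (leq_trans ltN) ?dimvS.
- by rewrite prodvDr addvS // /Ky prodvA limg_ahom_id.
Qed.

Variable a : A.

(** The two adjacent copies of K in KaK KaK merge into one, so that each further
    factor KaK contributes only K a. *)
Lemma KaK_powS m : KaK_pow KA a m.+1 = (KA * <[a ^+ 1]> * KaK_pow KA a m)%VS.
Proof.
rewrite expr1; case: m => [|m] //=.
have KP : (KA * KaK KA a ^+ m.+1 = KaK KA a ^+ m.+1)%VS.
  by rewrite expvSl /KaK !prodvA limg_ahom_id.
by rewrite [LHS]expvSl -[in RHS]KP prodvA.
Qed.

Hypothesis Ua : a \is a GRing.unit.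

Let line_powS m : (<[a ^+ m.+1]> = <[a ^+ 1]> * <[a ^+ m]>)%VS.
Proof. by rewrite prodv_line -exprD. Qed.

Let line_exprVS m : (<[a ^- m.+1]> = <[a ^- m]> * <[a ^- 1]>)%VS.
Proof. by rewrite prodv_line exprS invrM ?unitrX // expr1. Qed.

Let line_Vmul : (<[a ^- 1]> * <[a ^+ 1]> = 1)%VS.
Proof. by rewrite prodv_line expr1 mulVr. Qed.

Lemma KamS m :
  Kam KA a m.+1 = (KA * (<[a ^+ 1]> * Kam KA a m * <[a ^- 1]>))%VS.
Proof.
exact: (twisted_powerS (xp := fun i => <[a ^+ i]>%VS) line_exprVS KaK_powS).
Qed.

Lemma Kam_big m : Kam KA a m =
  \big[@prodv F A/1%VS]_(i < m.+1) (<[a ^+ i]> * KA * <[a ^- i]>)%VS.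
Proof.
apply: (twisted_power_big (xp := fun i => <[a ^+ i]>%VS)
          (xn := fun i => <[a ^- i]>%VS) _ line_powS _ line_exprVS
          _ KaK_powS line_Vmul) => //.
by rewrite expr0 invr1.
Qed.

Lemma Kam0 : Kam KA a 0 = KA.
Proof. by rewrite /Kam /= expr0 invr1 prodv1. Qed.

(** The factor added by the step contains 1 = a^(m+1) a^-(m+1). *)
Lemma Kam_le m : (Kam KA a m <= Kam KA a m.+1)%VS.
Proof.
rewrite [Kam KA a m.+1]Kam_big big_ord_recr /= -Kam_big.
rewrite -{1}[Kam KA a m]prodv1 prodvSr // -memvE.
have UaX : a ^+ m.+1 \is a GRing.unit by rewrite unitrX.
by rewrite -(mulrV UaX) !memv_mul ?memv_line // -{1}[a ^+ _]mulr1
           memv_mul ?memv_line ?one_in_limg_ahom.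
Qed.

Lemma Kam_submodule m : (KA * Kam KA a m <= Kam KA a m)%VS.
Proof.
by case: m => [|m]; rewrite ?Kam0 ?KamS ?prodvA limg_ahom_id.
Qed.

Lemma dim_Kam m : \dim (Kam KA a m) = \dim (KaK_pow KA a m).
Proof. by rewrite dim_cosetv_unit // unitrV unitrX. Qed.

(** As K-submodules of A, the subspaces of the chain have F-dimension a multiple
    of n and at most n^2. *)
Lemma Kam_stabilizes n : \dim {:A} = (n ^ 2)%N -> \dim {:K} = n ->
  exists m, [/\ (m <= n)%N, stabilizes_at (Kam KA a) m
    & stabilizes_at (fun k => (\dim_KA (KaK_pow KA a k))%N) m].
Proof.
move=> dimA dimK.
have dKA : \dim KA = n by rewrite dim_limg_ahom.
have n_gt0 : (0 < n)%N by rewrite -dimK adim_gt0.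
have [|m|m [le_mn stK stdim]] := @orbit_stabilizes _
    (fun M => KA * (<[a ^+ 1]> * M * <[a ^- 1]>))%VS (Kam KA a)
    (fun M => \dim_KA M) n KamS.
- move=> m neq; rewrite ltn_divLR ?dKA //.
  rewrite divnK -?{1}dKA ?dvdn_dim_submodule ?Kam_submodule //.
  by rewrite ltnNge; apply: contra neq; rewrite eqEdim Kam_le.
- by rewrite dKA (leq_trans (leq_div2r n (dimvS (subvf _)))) // dimA mulKn.
exists m; split=> //; first exact: leq_trans (leq_addl _ _) le_mn.
by apply: eq_stabilizes_at stdim => k; rewrite dim_Kam.
Qed.

End Subspaces.

(** * The chain of subsets of the Galois group *)

Section Subsets.
Variables (F : fieldType) (L : splittingFieldType F).
Implicit Types S : {set gal_of {:L}}.
Variables (H : {group gal_of {:L}}) (g : gal_of {:L}).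

Lemma compSA : associative (@compS F L).
Proof. by move=> S1 S2 S3; rewrite /compS mulgA. Qed.

Lemma comp1S : left_id [set 1%g] (@compS F L).
Proof. by move=> S; rewrite /compS mulg1. Qed.

Lemma compS1 : right_id [set 1%g] (@compS F L).
Proof. by move=> S; rewrite /compS mul1g. Qed.

(* The law op of the twisted powers is composition of sets of automorphisms, the
   opposite of the set product; hence p_(m+1) = p_m * (g H) in the latter. *)
HB.instance Definition _ :=
  Monoid.isLaw.Build {set gal_of {:L}} [set 1%g] (@compS F L) compSA comp1S compS1.

Lemma compS_set1 (s t : gal_of {:L}) : compS [set s] [set t] = [set (t * s)%g].
Proof. exact: mulg_set1. Qed.

Lemma HgH_powS m :
  HgH_pow H g m.+1 = compS (compS H [set (g ^+ 1)%g]) (HgH_pow H g m).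
Proof.
rewrite expg1; case: m => [|m] //=.
have PH : (HgH H g ^+ m.+1 * H = HgH H g ^+ m.+1)%g.
  by rewrite expgSr /HgH /compS -!mulgA mulGid.
by rewrite [LHS]expgSr -[in RHS]PH /compS -!mulgA.
Qed.

Let set1_expgS m : [set (g ^+ m.+1)%g] = compS [set (g ^+ 1)%g] [set (g ^+ m)%g].
Proof. by rewrite compS_set1 -expgD addn1. Qed.

Let set1_expgVS m : [set (g ^- m.+1)%g] = compS [set (g ^- m)%g] [set (g ^- 1)%g].
Proof. by rewrite compS_set1 -invMg -expgD addn1. Qed.

Let set1_Vmul : compS [set (g ^- 1)%g] [set (g ^+ 1)%g] = [set 1%g].
Proof. by rewrite compS_set1 mulgV. Qed.

Lemma HgmS m :
  Hgm H g m.+1 =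
    compS H (compS (compS [set (g ^+ 1)%g] (Hgm H g m)) [set (g ^- 1)%g]).
Proof.
exact: (twisted_powerS (xp := fun i => [set (g ^+ i)%g]) set1_expgVS HgH_powS).
Qed.

Lemma Hgm_big m : Hgm H g m =
  \big[@compS F L/[set 1%g]]_(i < m.+1)
     compS (compS [set (g ^+ i)%g] H) [set (g ^- i)%g].
Proof.
apply: (twisted_power_big (xp := fun i => [set (g ^+ i)%g])
          (xn := fun i => [set (g ^- i)%g]) _ set1_expgS _ set1_expgVS
          _ HgH_powS set1_Vmul) => //.
by rewrite expg0 invg1.
Qed.

Lemma Hgm0 : Hgm H g 0 = H.
Proof. by rewrite /Hgm expg0 invg1 compS1. Qed.

Lemma Hgm_sub m : Hgm H g m \subset Hgm H g m.+1.
Proof.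
rewrite [Hgm H g m.+1]Hgm_big big_ord_recr /= -Hgm_big.
rewrite -{1}[Hgm H g m]compS1 mulSg // sub1set.
by rewrite -(mulVg (g ^+ m.+1)%g) mem_mulg ?set11 // -{1}[(g ^+ _)%g]mul1g
           mem_mulg ?set11.
Qed.

Lemma card_Hgm m : #|Hgm H g m| = #|HgH_pow H g m|.
Proof. exact: card_lcoset. Qed.

Lemma HgH_pow_stabilizes : exists m, stabilizes_at (fun k => #|HgH_pow H g k|) m.
Proof.
have [m neq|m|m [_ _ stcard]] := @orbit_stabilizes _
    (fun S => compS H (compS (compS [set (g ^+ 1)%g] S) [set (g ^- 1)%g]))
    (Hgm H g) (fun S => #|S|) #|{: gal_of {:L}}| HgmS.
- by rewrite proper_card // properEneq neq Hgm_sub.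
- exact: max_card.
by exists m; apply: eq_stabilizes_at stcard => k; rewrite card_Hgm.
Qed.

End Subsets.

Theorem lemma26 (F : fieldType) (A : falgType F) (n : nat)
    (K : fieldExtType F) (jA : 'AHom(K, A))
    (L : splittingFieldType F) (jL : 'AHom(K, L))
    (T : falgType F) (tens : {bilinear K -> K -> T})
    (g : gal_of {:L}) (a : A) :
  central_simple A ->
  \dim {:A} = (n ^ 2)%N ->
  maximal_subfield (limg jA) ->
  separable 1%VS {:K} ->
  \dim {:K} = n ->
  galois_closure jL ->
  is_tensor_square tens ->
  g \in 'Gal({:L} / 1)%g ->
  a \is a GRing.unit ->
  simple_bimodule (limg jA) (KaK (limg jA) a) ->
  associated_bimodule jA jL tens g (KaK (limg jA) a) ->
  let KA := limg jA in
  let H : {set gal_of {:L}} := 'Gal({:L} / limg jL)%g in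
  [/\ (forall m, Kam KA a m =
         \big[@prodv F A/1%VS]_(i < m.+1) (<[a ^+ i]> * KA * <[a ^- i]>)%VS),
      (forall m, Kam KA a m = Kam KA a m.+1 ->
         forall s, Kam KA a m = Kam KA a (m + s)%N),
      Kam KA a 0 = KA /\ (forall m, (Kam KA a m <= Kam KA a m.+1)%VS),
      (exists m, [/\ (m <= n)%N, stabilizes_at (Kam KA a) m
         & stabilizes_at (fun k => (\dim_KA (KaK_pow KA a k))%N) m])
    & [/\ (forall m, Hgm H g m =
             \big[@compS F L/[set 1%g]]_(i < m.+1)
               compS (compS [set (g ^+ i)%g] H) [set (g ^- i)%g]),
          Hgm H g 0 = H,
          (forall m, Hgm H g m \subset Hgm H g m.+1)
        & (exists m, stabilizes_at (fun k => #|HgH_pow H g k|) m)]].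
Proof.
move=> _ dimA _ _ dimK _ _ _ Ua _ _ KA H; split.
- exact: Kam_big.
- exact: (@orbit_stationary _
    (fun M => KA * (<[a ^+ 1]> * M * <[a ^- 1]>))%VS _ (KamS jA Ua)).
- by split; [exact: Kam0 | exact: Kam_le].
- exact: Kam_stabilizes.
- split; [exact: Hgm_big | exact: Hgm0 | exact: Hgm_sub|].
  exact: HgH_pow_stabilizes.
Qed.
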